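(* Let $\alpha\in[0,1)$ be a rational with continued fraction expansion $[0,a_1,\dots,a_r,1]$ and convergents $p_k/q_k$ ($0\leqslant k\leqslant r+1$). (i) The map $$\Lambda_\alpha : E_\alpha\to\left\{\tfrac{n}{q_{r+1}} : n\in\{0,\dots,q_{r+1}-1\}\right\},\qquad d\mapsto\sum_{j=1}^r(-1)^{j-1}d_j\delta_{j-1}$$ is an order isomorphism, where $E_\alpha$ carries the alternate lexicographic order $\leqslant_A$ and the target carries the usual order. (ii) For all $n\in\{0,\dots,q_{r+1}-1\}$, $\{n\alpha\}=\Lambda_\alpha(\Psi_\alpha^{-1}(n))$, where $\Psi_\alpha : E_\alpha\to\{0,\dots,q_{r+1}-1\}$ is the bijection $d\mapsto\sum_{j=1}^r d_jq_{j-1}$.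
   Context: $\{x\}$ denotes the fractional part of $x$. Every rational $\alpha\in(0,1)$ has a unique continued fraction expansion ending in $1$: $\alpha=[0,a_1,\dots,a_r,1]$ with $r\geqslant1$ and positive integers $a_1,\dots,a_r$, where $[x]=x$ and $[x,x_1,\dots,x_n]=x+1/[x_1,\dots,x_n]$. Put $a_0=0$, $a_{r+1}=1$, $p_{-1}=1,\ q_{-1}=0,\ p_0=0,\ q_0=1$, and $p_n=a_np_{n-1}+p_{n-2}$, $q_n=a_nq_{n-1}+q_{n-2}$ for $1\leqslant n\leqslant r+1$; thus $\alpha=p_{r+1}/q_{r+1}$ in lowest terms. Put $\delta_i=(-1)^i(q_i\alpha-p_i)$ for $-1\leqslant i\leqslant r$ (so $\delta_{-1}=1$, $\delta_0=\alpha$). $E_\alpha$ is the set of $\alpha$-admissible sequences: sequences $d=(d_1,\dots,d_r)$ of nonnegative integers such that for all $j\in\{1,\dots,r\}$: $0\leqslant d_j\leqslant a_j$, and if $d_j=0$ then either $d_i=0$ for all $i\geqslant j$, or $j\geqslant2$ and $d_{j-1}=a_{j-1}$. Alternate lexicographic order: $d\leqslant_A d'$ iff $d=d'$ or there is $j\in\{1,\dots,r\}$ with $(-1)^{j-1}d_j<(-1)^{j-1}d'_j$ and $d_i=d'_i$ for all $i<j$. *)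

(* Defs.v *)
From mathcomp Require Import all_boot all_order all_algebra.
From mathcomp Require Import archimedean.
From mathcomp Require Import classical_sets functions.

Set Implicit Arguments.
Unset Strict Implicit.
Unset Printing Implicit Defensive.

Import Order.TTheory GRing.Theory Num.Theory.
Local Open Scope classical_set_scope.
Local Open Scope ring_scope.

(* [x] = x and [x, x_1, ..., x_n] = x + 1 / [x_1, ..., x_n]. *)
Fixpoint cfrac (x : rat) (s : seq rat) : rat :=
  if s is y :: s' then x + (cfrac y s')^-1 else x.

(* The tuple a = (a_1, ..., a_r) is indexed from 0 (a_j is [tnth a (j - 1)]);
   [pquot a n] restores the indexing from 0 to r + 1, with a_0 = 0 and
   a_(r+1) = 1. *)
Definition pquot (r : nat) (a : r.-tuple nat) (n : nat) : nat :=
  nth 0%N (0%N :: rcons a 1%N) n.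

(* [0, a_1, ..., a_r, 1] *)
Definition cfrac_of (r : nat) (a : r.-tuple nat) : rat :=
  cfrac 0 [seq k%:R | k <- rcons a 1%N].

(* u_n = c_n u_(n-1) + u_(n-2) for n >= 1, where v = u_(-1) and w = u_0. *)
Fixpoint cvg_rec (c : nat -> nat) (v w n : nat) : nat :=
  match n with
  | 0 => w
  | m.+1 => (c n * cvg_rec c v w m
             + match m with 0 => v | k.+1 => cvg_rec c v w k end)%N
  end.

Definition cvg_num (r : nat) (a : r.-tuple nat) : nat -> nat :=
  cvg_rec (pquot a) 1 0.

Definition cvg_den (r : nat) (a : r.-tuple nat) : nat -> nat :=
  cvg_rec (pquot a) 0 1.

Definition delta (r : nat) (a : r.-tuple nat) (i : nat) : rat :=
  (-1) ^+ i * ((cvg_den a i)%:R * cfrac_of a - (cvg_num a i)%:R).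

(* In the following definitions the ordinal j stands for the index j + 1 of
   the sequences (d_1, ..., d_r) and (a_1, ..., a_r), so that (-1)^(j-1),
   delta_(j-1) and q_(j-1) become (-1)^j, delta_j and q_j. *)
Definition admissible (r : nat) (a : r.-tuple nat) : set (r.-tuple nat) :=
  [set d | forall j : 'I_r,
     (tnth d j <= tnth a j)%N /\
     (tnth d j = 0%N ->
        (forall i : 'I_r, (j <= i)%N -> tnth d i = 0%N) \/
        (exists2 k : 'I_r, j = k.+1 :> nat & tnth d k = tnth a k))].

Definition alt_lex (r : nat) (d d' : r.-tuple nat) : Prop :=
  d = d' \/
  exists2 j : 'I_r,
    (-1) ^+ j * (tnth d j)%:Z < (-1) ^+ j * (tnth d' j)%:Z &
    forall i : 'I_r, (i < j)%N -> tnth d i = tnth d' i.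

Definition Lambda (r : nat) (a d : r.-tuple nat) : rat :=
  \sum_(j < r) (-1) ^+ j * (tnth d j)%:R * delta a j.

Definition Psi (r : nat) (a d : r.-tuple nat) : nat :=
  (\sum_(j < r) tnth d j * cvg_den a j)%N.

Definition order_isomorphism (T U : Type) (leT : T -> T -> Prop)
    (leU : U -> U -> Prop) (A : set T) (B : set U) (f : T -> U) : Prop :=
  set_bij A B f /\
  (forall x y, A x -> A y -> (leT x y <-> leU (f x) (f y))).

Definition fracpart (x : rat) : rat := x - (Num.floor x)%:~R.

(* Inverse of Psi on admissible sequences; the default value (0, ..., 0) is
   only taken outside the range of Psi. *)
Definition Psi_inv (r : nat) (a : r.-tuple nat) : nat -> r.-tuple nat :=
  'pinv_(fun=> [tuple of nseq r 0%N]) (admissible a) (Psi a).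

(* Main.v *)
Require Import Defs.
From mathcomp Require Import all_boot all_order all_algebra.
From mathcomp Require Import archimedean ring lra zify.
From mathcomp Require Import classical_sets functions.

Import Order.TTheory GRing.Theory Num.Theory.
Local Open Scope classical_set_scope.
Local Open Scope ring_scope.

(** Write alpha = [0, a_1, ..., a_r, 1] = p_(r+1) / q_(r+1).  Everything rests
    on the congruence Psi(d) alpha = Lambda(d) modulo 1 ([Lambda_Psi]), which
    holds because (-1)^(j-1) delta_(j-1) = q_(j-1) alpha - p_(j-1).

    The order.  The recurrence delta_i = delta_(i-2) - a_i delta_(i-1) makes
    alternating sums telescope, so for digits with d_j <= a_j the tail
    T_k = d_k delta_(k-1) - d_(k+1) delta_k + ... lies between
    -(delta_(k-1) - delta_r) and delta_(k-2) - delta_r ([tail_bounds]).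
    Admissibility improves the lower bound: T_k >= 0 unless the digit before
    position k is maximal ([tail_ge0]).  Hence Lambda takes its values in
    [0, 1) ([Lambda_bounds]), and the first place where two admissible
    sequences differ decides how their images compare: the smaller of the two
    digits there is not maximal, so the tail after it is nonnegative, while the
    other tail stays below delta_(k-1), the weight of one unit of the digit
    ([tail_lt]).  Thus Lambda is strictly increasing for the alternate
    lexicographic order, in particular injective.

    The bijections.  As Lambda(d) is in [0, 1), it is the fractional part of
    Psi(d) alpha ([Lambda_fracpart]), so Psi inherits the injectivity of
    Lambda.  The bound d_j <= a_j and telescoping give Psi(d) < q_(r+1), and a
    greedy expansion from the top digit reaches every n < q_(r+1)
    ([digits_exist], [Psi_surj]).  Finally delta_r = 1 / q_(r+1) says that
    (-1)^r q_r alpha = 1 / q_(r+1) modulo 1, so n / q_(r+1) is the fractional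
    part of m alpha for m = (-1)^r n q_r modulo q_(r+1), hence the value of
    Lambda at the sequence whose Psi is m ([Lambda_surj]). *)

(** * Denominators and the numbers delta *)

(** The value at [k] is q_(k-1): the shift makes room for q_(-1) = 0, so that
    the recurrence has no exceptional case.  The next definition does the same
    for delta_(k-1), with delta_(-1) = 1. *)
Definition prev_den {r} (a : r.-tuple nat) (k : nat) : nat :=
  if k is n.+1 then cvg_den a n else 0%N.

Definition prev_delta {r} (a : r.-tuple nat) (k : nat) : rat :=
  if k is n.+1 then delta a n else 1.

Lemma prev_den_rec {r} (a : r.-tuple nat) (k : nat) :
  prev_den a k.+2 = (pquot a k.+1 * prev_den a k.+1 + prev_den a k)%N.
Proof. by case: k. Qed.

Lemma prev_delta_rec {r} (a : r.-tuple nat) (k : nat) :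
  prev_delta a k.+2 = prev_delta a k - (pquot a k.+1)%:R * prev_delta a k.+1.
Proof.
have rec v w n : cvg_rec (pquot a) v w n.+2 =
    (pquot a n.+2 * cvg_rec (pquot a) v w n.+1 + cvg_rec (pquot a) v w n)%N.
  by [].
rewrite [LHS]/prev_delta /delta /cvg_den /cvg_num.
case: k => [|k].
  have rec1 v w : cvg_rec (pquot a) v w 1 = (pquot a 1 * w + v)%N by [].
  rewrite !rec1 muln1 muln0 addn0 add0n /prev_delta /delta expr1 expr0.
  have [-> ->] : cvg_den a 0 = 1%N /\ cvg_num a 0 = 0%N by [].
  by rewrite mul1r; ring.
rewrite !rec !natrD !natrM !exprS /prev_delta /delta /cvg_den /cvg_num !exprS.
by ring.
Qed.

Lemma pquot_gt0 {r} (a : r.-tuple nat) (k : nat) :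
  (forall j : 'I_r, (0 < tnth a j)%N) -> (k <= r)%N -> (0 < pquot a k.+1)%N.
Proof.
move=> ha; rewrite /pquot /= nth_rcons size_tuple leq_eqVlt.
case/orP => [/eqP -> | ltkr]; first by rewrite ltnn eqxx.
by rewrite ltkr; have := ha (Ordinal ltkr); rewrite (tnth_nth 0%N).
Qed.

Lemma pquot_tnth {r} (a : r.-tuple nat) (j : 'I_r) :
  pquot a j.+1 = tnth a j.
Proof. by rewrite /pquot /= nth_rcons size_tuple ltn_ord (tnth_nth 0%N). Qed.

Lemma pquot_last {r} (a : r.-tuple nat) : pquot a r.+1 = 1%N.
Proof. by rewrite /pquot /= nth_rcons size_tuple ltnn eqxx. Qed.

Lemma leq_prev_den {r} (a : r.-tuple nat) (k : nat) :
  (forall j : 'I_r, (0 < tnth a j)%N) -> (k <= r.+1)%N ->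
  (prev_den a k <= prev_den a k.+1)%N.
Proof.
move=> ha; case: k => [//|k] lekr.
rewrite prev_den_rec; apply: leq_trans (leq_addr _ _).
by rewrite leq_pmull ?pquot_gt0.
Qed.

Lemma prev_den_gt0 {r} (a : r.-tuple nat) (k : nat) :
  (forall j : 'I_r, (0 < tnth a j)%N) -> (k <= r.+1)%N ->
  (0 < prev_den a k.+1)%N.
Proof.
move=> ha; elim: k => [//|k IHk] lekr.
exact: leq_trans (IHk (ltnW lekr)) (leq_prev_den a _ ha lekr).
Qed.

(** [a_(k+1), ..., a_r, 1], the quantity through which the numbers delta are
    seen to be positive: their defining formula hides the sign. *)
Definition complete_quotient {r} (a : r.-tuple nat) (k : nat) : rat :=
  cfrac (pquot a k.+1)%:R [seq n%:R | n <- drop k.+1 (rcons a 1%N)].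

Lemma cfrac_gt0 (x : rat) (s : seq rat) :
  0 < x -> all (> 0) s -> 0 < cfrac x s.
Proof.
elim: s x => [//|y s IHs] x x_gt0 /= /andP[y_gt0 s_gt0].
by rewrite addr_gt0 // invr_gt0 IHs.
Qed.

Lemma complete_quotient_gt0 {r} (a : r.-tuple nat) (k : nat) :
  (forall j : 'I_r, (0 < tnth a j)%N) -> (k <= r)%N ->
  0 < complete_quotient a k.
Proof.
move=> ha lekr; apply: cfrac_gt0; first by rewrite ltr0n pquot_gt0.
rewrite all_map; apply/allP => n /mem_drop /=.
rewrite mem_rcons inE ltr0n => /orP[/eqP -> //|/tnthP[j ->]]; exact: ha.
Qed.

Lemma complete_quotient_rec {r} (a : r.-tuple nat) (k : nat) : (k < r)%N ->
  complete_quotient a k =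
    (pquot a k.+1)%:R + (complete_quotient a k.+1)^-1.
Proof.
move=> ltkr; rewrite {1}/complete_quotient.
by rewrite (drop_nth 0%N) // size_rcons size_tuple.
Qed.

Lemma complete_quotient_last {r} (a : r.-tuple nat) :
  complete_quotient a r = 1.
Proof.
by rewrite /complete_quotient drop_oversize ?size_rcons ?size_tuple //= pquot_last.
Qed.

Lemma cfrac_of_complete_quotient {r} (a : r.-tuple nat) :
  cfrac_of a = (complete_quotient a 0)^-1.
Proof.
rewrite /cfrac_of -[rcons a 1%N]drop0 (drop_nth 0%N) ?size_rcons //=.
by rewrite add0r.
Qed.

(** The recurrence of the numbers delta is Euclid's algorithm on (1, alpha), and
    complete quotients are the ratios of consecutive remainders. *)
Lemma prev_delta_complete_quotient {r} (a : r.-tuple nat) (k : nat) :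
  (forall j : 'I_r, (0 < tnth a j)%N) -> (k <= r)%N ->
  prev_delta a k = complete_quotient a k * prev_delta a k.+1.
Proof.
move=> ha; elim: k => [_|k IHk ltkr].
  rewrite /= /delta cfrac_of_complete_quotient expr0 !mul1r subr0 mulfV //.
  by rewrite gt_eqF ?complete_quotient_gt0.
rewrite prev_delta_rec (IHk (ltnW ltkr)) (complete_quotient_rec _ _ ltkr).
have /lt0r_neq0 := complete_quotient_gt0 a _ ha ltkr.
by move=> nz; field.
Qed.

Lemma prev_delta_gt0 {r} (a : r.-tuple nat) (k : nat) :
  (forall j : 'I_r, (0 < tnth a j)%N) -> (k <= r.+1)%N -> 0 < prev_delta a k.
Proof.
move=> ha; elim: k => [//|k IHk] lekr.
have := IHk (ltnW lekr); rewrite (prev_delta_complete_quotient a k ha) //.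
by rewrite pmulr_rgt0 // complete_quotient_gt0.
Qed.

(** The expansion ends in 1, so the last two remainders agree; this is where the
    normalization of the expansion enters. *)
Lemma prev_delta_last {r} (a : r.-tuple nat) :
  (forall j : 'I_r, (0 < tnth a j)%N) -> prev_delta a r = prev_delta a r.+1.
Proof.
move=> ha; rewrite prev_delta_complete_quotient //.
by rewrite complete_quotient_last mul1r.
Qed.

Lemma delta_top {r} (a : r.-tuple nat) :
  (forall j : 'I_r, (0 < tnth a j)%N) -> delta a r.+1 = 0.
Proof.
move=> ha; rewrite -[delta a r.+1]/(prev_delta a r.+2) prev_delta_rec.
by rewrite pquot_last mul1r prev_delta_last // subrr.
Qed.

(** This quantity is invariant because both sequences obey the same recurrence
    up to the sign of the partial quotient; it replaces the determinant of two
    consecutive convergents. *)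
Lemma den_delta_det {r} (a : r.-tuple nat) (k : nat) :
  (prev_den a k.+1)%:R * prev_delta a k
    + (prev_den a k)%:R * prev_delta a k.+1 = 1.
Proof.
elim: k => [|k IHk]; first by rewrite /= mulr1 mul0r addr0.
rewrite -[RHS]IHk prev_den_rec prev_delta_rec natrD natrM; ring.
Qed.

Lemma cfrac_ofE {r} (a : r.-tuple nat) :
  (forall j : 'I_r, (0 < tnth a j)%N) ->
  (cvg_den a r.+1)%:R * cfrac_of a = (cvg_num a r.+1)%:R.
Proof.
move=> ha; have /eqP := delta_top a ha.
by rewrite /delta mulf_eq0 signr_eq0 subr_eq0 => /eqP.
Qed.

Lemma delta_last {r} (a : r.-tuple nat) :
  (forall j : 'I_r, (0 < tnth a j)%N) ->
  delta a r = ((cvg_den a r.+1)%:R)^-1.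
Proof.
move=> ha; have := den_delta_det a r.+1.
rewrite [prev_delta a r.+2]delta_top // mulr0 addr0 /= => det.
have nz : (cvg_den a r.+1)%:R != 0 :> rat.
  by rewrite pnatr_eq0 -lt0n (prev_den_gt0 a r.+1 ha).
by apply: (mulfI nz); rewrite det mulfV.
Qed.

(** * Tails of the alternating expansion *)

(** The sign is normalized so that the digit at [k] counts positively.  Here
    digits are counted from 0, so that T_k = d_k delta_k - T_(k+1) for the tail
    T_k at [k]. *)
Definition tail {r} (a d : r.-tuple nat) (k : nat) : rat :=
  \sum_(k <= i < r) (-1) ^+ (i - k) * (nth 0%N d i)%:R * delta a i.

Lemma tail_oversize {r} (a d : r.-tuple nat) (k : nat) : (r <= k)%N ->
  tail a d k = 0.
Proof. by move=> lerk; rewrite /tail big_geq. Qed.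

Lemma tail_rec {r} (a d : r.-tuple nat) (k : nat) : (k < r)%N ->
  tail a d k = (nth 0%N d k)%:R * prev_delta a k.+1 - tail a d k.+1.
Proof.
move=> ltkr; rewrite /tail big_ltn // subnn expr0 mul1r -sumrN.
congr (_ + _); apply: eq_big_nat => i /andP[ltki _].
by rewrite -[(i - k)%N]prednK ?subn_gt0 // -subnS exprS mulN1r !mulNr.
Qed.

Lemma Lambda_tail {r} (a d : r.-tuple nat) : Lambda a d = tail a d 0.
Proof.
rewrite /Lambda /tail big_mkord; apply: eq_bigr => i _.
by rewrite subn0 (tnth_nth 0%N).
Qed.

(** Isolates a common prefix: sequences that agree before [k] are compared
    through their tails at [k]. *)
Lemma Lambda_split {r} (a d : r.-tuple nat) (k : nat) : (k <= r)%N ->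
  Lambda a d = \sum_(0 <= i < k) (-1) ^+ i * (nth 0%N d i)%:R * delta a i
               + (-1) ^+ k * tail a d k.
Proof.
move=> lekr; rewrite Lambda_tail /tail (big_cat_nat _ (n := k)) //=.
congr (_ + _); first by apply: eq_bigr => i _; rewrite subn0.
rewrite mulr_sumr; apply: eq_big_nat => i /andP[leki _].
by rewrite subn0 !mulrA -exprD subnKC.
Qed.

Lemma admissible_nth {r} (a d : r.-tuple nat) :
  admissible a d <-> forall j, (j < r)%N ->
    (nth 0%N d j <= pquot a j.+1)%N /\
    (nth 0%N d j = 0%N ->
      (forall i, (j <= i)%N -> nth 0%N d i = 0%N) \/
      (exists2 k, j = k.+1 & nth 0%N d k = pquot a k.+1)).
Proof.
split=> [adm j ltjr | adm j].
  have [le_da zero_d] := adm (Ordinal ltjr).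
  rewrite -[j]/(val (Ordinal ltjr)) pquot_tnth -tnth_nth.
  split=> // /zero_d[tail0 | [k def_j max_k]]; [left=> i leji | right].
    have [ltir | leri] := ltnP i r; last by rewrite nth_default ?size_tuple.
    by have := tail0 (Ordinal ltir) leji; rewrite (tnth_nth 0%N).
  by exists k => //; rewrite pquot_tnth -max_k (tnth_nth 0%N).
have [le_da zero_d] := adm _ (ltn_ord j).
rewrite -(pquot_tnth a) (tnth_nth 0%N d); split=> // /zero_d[tail0 | [k def_j max_k]].
  by left=> i leji; rewrite (tnth_nth 0%N) tail0.
have ltkr : (k < r)%N by rewrite -ltnS -def_j ltnW // ltnS ltn_ord.
by right; exists (Ordinal ltkr); rewrite // -(pquot_tnth a) (tnth_nth 0%N d).
Qed.

(** The extreme values take maximal digits at every other place, starting at [k]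
    for the upper bound and at [k.+1] for the lower one; those sums telescope,
    and both stop at [delta a r] since the last two deltas are equal.  Downward
    induction proves both bounds together because T_k = d_k delta_k - T_(k+1)
    exchanges them. *)
Lemma tail_bounds {r} (a d : r.-tuple nat) (k : nat) :
  (forall j : 'I_r, (0 < tnth a j)%N) ->
  (forall j, (j < r)%N -> (nth 0%N d j <= pquot a j.+1)%N) -> (k <= r)%N ->
  - (prev_delta a k.+1 - delta a r) <= tail a d k
    <= prev_delta a k - delta a r.
Proof.
move=> ha le_da lekr; rewrite -(subKn lekr).
elim: (r - k)%N (leq_subr k r) => [_|m IHm ltmr].
  by rewrite subn0 tail_oversize // prev_delta_last // !subrr oppr0 lexx.
(* The position n below is r - m.+1, one step down from r - m. *)
have {lekr} lt_nr : (r - m.+1 < r)%N by rewrite -subn_gt0 subKn.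
move: IHm; rewrite -(subnSK ltmr).
move: (r - m.+1)%N lt_nr => n lt_nr /(_ (ltnW ltmr))/andP[].
rewrite prev_delta_rec (tail_rec _ _ _ lt_nr) => lo hi.
have digit_ge0 : 0 <= (nth 0%N d n)%:R :> rat by [].
have digit_le : (nth 0%N d n)%:R <= (pquot a n.+1)%:R :> rat.
  by rewrite ler_nat le_da.
have pd_ge0 : 0 <= prev_delta a n.+1.
  by rewrite ltW // prev_delta_gt0 // ltnS ltnW.
have := ler_wpM2r pd_ge0 digit_le; have := mulr_ge0 digit_ge0 pd_ge0.
lra.
Qed.

(** A zero digit that follows a non-maximal one starts a zero tail; a digit at
    least 1 contributes more than the rest of the tail can remove.  For [k = 0]
    the hypothesis on the preceding digit is vacuous. *)
Lemma tail_ge0 {r} (a d : r.-tuple nat) (k : nat) :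
  (forall j : 'I_r, (0 < tnth a j)%N) -> admissible a d -> (k <= r)%N ->
  (forall i, k = i.+1 -> nth 0%N d i != pquot a k) -> 0 <= tail a d k.
Proof.
move=> ha /admissible_nth adm; rewrite leq_eqVlt.
case/orP => [/eqP -> _ | ltkr prev_d]; first by rewrite tail_oversize.
have [dk0 | dk_gt0] := posnP (nth 0%N d k).
  have [_ /(_ dk0)[tail0 | [i def_k max_i]]] := adm k ltkr.
    rewrite /tail big_nat_cond big1 // => i /andP[/andP[leki _] _].
    by rewrite tail0 // mulr0 mul0r.
  by have := prev_d i def_k; rewrite max_i def_k eqxx.
have := tail_bounds a d k.+1 ha (fun j ltjr => (adm j ltjr).1) ltkr.
have eps_gt0 : 0 < delta a r := prev_delta_gt0 a r.+1 ha (leqnn _).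
have pd_ge0 : 0 <= prev_delta a k.+1.
  by rewrite ltW // prev_delta_gt0 // ltnS ltnW.
have digit_ge1 : 1 <= (nth 0%N d k)%:R :> rat by rewrite ler1n.
have := ler_wpM2r pd_ge0 digit_ge1; rewrite (tail_rec _ _ _ ltkr) => ? /andP[_ ?].
lra.
Qed.

Lemma Lambda_bounds {r} (a d : r.-tuple nat) :
  (forall j : 'I_r, (0 < tnth a j)%N) -> admissible a d ->
  0 <= Lambda a d < 1.
Proof.
move=> ha adm; rewrite Lambda_tail tail_ge0 //=.
have/admissible_nth adm' := adm.
have /andP[_] := tail_bounds a d 0 ha (fun j ltjr => (adm' j ltjr).1) (leq0n r).
move/le_lt_trans; apply; rewrite gtrBl.
exact: (prev_delta_gt0 a r.+1).
Qed.

(** The gain of at least one unit of the digit at [k] exceeds the variation of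
    the rest: the rest of [d] is nonnegative because the smaller digit cannot be
    maximal, and the rest of [d'] is at most one unit minus [delta a r]. *)
Lemma tail_lt {r} (a d d' : r.-tuple nat) (k : nat) :
  (forall j : 'I_r, (0 < tnth a j)%N) ->
  admissible a d -> admissible a d' -> (k < r)%N ->
  (nth 0%N d k < nth 0%N d' k)%N -> tail a d k < tail a d' k.
Proof.
move=> ha adm adm' ltkr ltdd'; rewrite (tail_rec _ d _ ltkr) (tail_rec _ d' _ ltkr).
have /admissible_nth box' := adm'.
have tail_d_ge0 : 0 <= tail a d k.+1.
  apply: tail_ge0 => // i [<-]; rewrite neq_ltn.
  by rewrite (leq_trans ltdd') // (box' k ltkr).1.
have /andP[_ tail_d'_le] :=
  tail_bounds a d' k.+1 ha (fun j ltjr => (box' j ltjr).1) ltkr.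
have eps_gt0 : 0 < delta a r := prev_delta_gt0 a r.+1 ha (leqnn _).
have pd_ge0 : 0 <= prev_delta a k.+1.
  by rewrite ltW // prev_delta_gt0 // ltnS ltnW.
have gap : (nth 0%N d k)%:R + 1 <= (nth 0%N d' k)%:R :> rat.
  by rewrite natr1 ler_nat.
have := ler_wpM2r pd_ge0 gap; rewrite mulrDl mul1r.
lra.
Qed.

(** * The alternate lexicographic order *)

(** The same sign (-1)^j governs the comparison of the digits at [j] in the
    order and the comparison of the tails at [j] in the sum, so [tail_lt]
    applies to the pair in one direction or the other. *)
Lemma Lambda_lt {r} (a d d' : r.-tuple nat) (j : 'I_r) :
  (forall j : 'I_r, (0 < tnth a j)%N) ->
  admissible a d -> admissible a d' ->
  (-1) ^+ j * (tnth d j)%:Z < (-1) ^+ j * (tnth d' j)%:Z ->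
  (forall i : 'I_r, (i < j)%N -> tnth d i = tnth d' i) ->
  Lambda a d < Lambda a d'.
Proof.
move=> ha adm adm' lt_j eq_j.
rewrite !(Lambda_split a _ j (ltnW (ltn_ord j))).
have -> : \sum_(0 <= i < j) (-1) ^+ i * (nth 0%N d i)%:R * delta a i =
          \sum_(0 <= i < j) (-1) ^+ i * (nth 0%N d' i)%:R * delta a i.
  apply: eq_big_nat => i /andP[_ ltij].
  have := eq_j (Ordinal (ltn_trans ltij (ltn_ord j))) ltij.
  by rewrite !(tnth_nth 0%N) /= => ->.
rewrite ltrD2l; move: lt_j; rewrite !(tnth_nth 0%N) -signr_odd -(signr_odd rat).
case: (odd j); rewrite ?expr1 ?expr0 ?mulN1r ?mul1r ?ltrN2 ltz_nat => lt_j;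
  exact: tail_lt.
Qed.

Lemma alt_lex_total {r} (d d' : r.-tuple nat) :
  [\/ d = d',
      exists2 j : 'I_r, (-1) ^+ j * (tnth d j)%:Z < (-1) ^+ j * (tnth d' j)%:Z &
        forall i : 'I_r, (i < j)%N -> tnth d i = tnth d' i
    | exists2 j : 'I_r, (-1) ^+ j * (tnth d' j)%:Z < (-1) ^+ j * (tnth d j)%:Z &
        forall i : 'I_r, (i < j)%N -> tnth d' i = tnth d i].
Proof.
have [-> | neq_dd'] := eqVneq d d'; first by constructor 1.
have /existsP[j0 neq_j0] : [exists j, tnth d j != tnth d' j].
  apply: contraR neq_dd'; rewrite negb_exists => /forallP eq_dd'.
  by apply/eqP/eq_from_tnth => j; apply/eqP; rewrite -[_ == _]negbK.
case: (@arg_minnP _ j0 (fun j => tnth d j != tnth d' j) val neq_j0) => j neq_j min_j.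
have eq_before (i : 'I_r) : (i < j)%N -> tnth d i = tnth d' i.
  by move=> ltij; apply/eqP; apply: contraLR ltij => /min_j; rewrite -leqNgt.
have : (-1) ^+ j * (tnth d j)%:Z != (-1) ^+ j * (tnth d' j)%:Z.
  by rewrite (inj_eq (mulfI _)) ?signr_eq0 // eqz_nat.
rewrite neq_lt => /orP[lt_j | lt_j].
  by constructor 2; exists j.
by constructor 3; exists j => // i /eq_before.
Qed.

Lemma alt_lex_Lambda {r} (a d d' : r.-tuple nat) :
  (forall j : 'I_r, (0 < tnth a j)%N) ->
  admissible a d -> admissible a d' ->
  alt_lex d d' <-> Lambda a d <= Lambda a d'.
Proof.
move=> ha adm adm'; split=> [[-> // | [j lt_j eq_j]] | leL].
  by rewrite ltW // (Lambda_lt _ _ _ _ ha adm adm' lt_j).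
case: (alt_lex_total d d') => [-> | lt_dd' | [j lt_j eq_j]]; [by left | by right |].
by have := Lambda_lt _ _ _ _ ha adm' adm lt_j eq_j; rewrite ltNge leL.
Qed.

Lemma Lambda_inj {r} (a d d' : r.-tuple nat) :
  (forall j : 'I_r, (0 < tnth a j)%N) ->
  admissible a d -> admissible a d' -> Lambda a d = Lambda a d' -> d = d'.
Proof.
move=> ha adm adm' eqL.
case: (alt_lex_total d d') => [// | [j lt_j eq_j] | [j lt_j eq_j]].
  by have := Lambda_lt _ _ _ _ ha adm adm' lt_j eq_j; rewrite eqL ltxx.
by have := Lambda_lt _ _ _ _ ha adm' adm lt_j eq_j; rewrite eqL ltxx.
Qed.

(** * Expansions of integers *)

(** a_j q_(j-1) = q_j - q_(j-2), so the sum telescopes. *)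
Lemma sum_pquot_den {r} (a : r.-tuple nat) (k : nat) :
  (\sum_(j < k) pquot a j.+1 * cvg_den a j).+1
    = (prev_den a k.+1 + prev_den a k)%N.
Proof.
elim: k => [|k IHk]; first by rewrite big_ord0.
rewrite big_ord_recr -addSn IHk prev_den_rec /= addnC -addnA.
by rewrite [(cvg_den a k + _)%N]addnC.
Qed.

Lemma den_last {r} (a : r.-tuple nat) :
  cvg_den a r.+1 = (prev_den a r.+1 + prev_den a r)%N.
Proof.
by rewrite -[LHS]/(prev_den a r.+2) prev_den_rec pquot_last mul1n.
Qed.

Lemma Psi_lt {r} (a d : r.-tuple nat) :
  admissible a d -> (Psi a d < cvg_den a r.+1)%N.
Proof.
move=> adm; rewrite den_last -sum_pquot_den ltnS; apply: leq_sum => j _.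
by rewrite pquot_tnth leq_mul2r (adm j).1 orbT.
Qed.

(** Greedy expansion for digits whose zeros all follow a maximal digit (in
    particular the first digit is not zero).  The sums of such sequences of
    length k are the n with q_(k-1) <= n < q_k + q_(k-1).  The second clause,
    that n >= q_k forces the last digit to be maximal, is what lets the next
    digit be 0. *)
Lemma digits_exist {r} (a : r.-tuple nat) (k n : nat) :
  (forall j : 'I_r, (0 < tnth a j)%N) -> (k <= r)%N ->
  (prev_den a k <= n < prev_den a k.+1 + prev_den a k)%N ->
  exists d : nat -> nat,
    [/\ forall j, (j < k)%N ->
          (d j <= pquot a j.+1)%N /\
          (d j = 0%N -> exists2 i, j = i.+1 & d i = pquot a i.+1),
        (prev_den a k.+1 <= n)%N ->
          exists2 i, k = i.+1 & d i = pquot a i.+1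
      & (\sum_(j < k) d j * cvg_den a j)%N = n].
Proof.
move=> ha; elim: k n => [|k IHk] n lekr /andP[lo hi].
  exists (fun=> 0%N); split=> // [le1n|]; first by rewrite ltnNge le1n in hi.
  by rewrite big_ord0; case: n lo hi => [|[|n]].
have den_gt0 := prev_den_gt0 a k ha (leqW (ltnW lekr)).
have den_le := leq_prev_den a k ha (leqW (ltnW lekr)).
have le_kn := leq_trans den_le lo.
(* The largest digit that leaves a remainder of at least [prev_den a k]; the
   remainder then lies in the range of the induction hypothesis. *)
pose e := ((n - prev_den a k) %/ prev_den a k.+1)%N.
pose n' := (n - e * prev_den a k.+1)%N.
have n_eq := divn_eq (n - prev_den a k) (prev_den a k.+1).
have rem_lt := ltn_pmod (n - prev_den a k) den_gt0.
rewrite -/e in n_eq.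
have n'_bounds : (prev_den a k <= n' < prev_den a k.+1 + prev_den a k)%N.
  by rewrite /n'; lia.
have n_split : (n' + e * prev_den a k.+1 = n)%N by rewrite /n'; lia.
have [d [adm_d top_d sum_d]] := IHk n' (ltnW lekr) n'_bounds.
rewrite prev_den_rec in hi *.
have e_le : (e <= pquot a k.+1)%N.
  rewrite -ltnS ltn_divLR //; lia.
exists (fun j => if j == k then e else d j); split=> [j|le_n|].
- rewrite ltnS leq_eqVlt; case: eqVneq => [-> _ | neq_jk /= ltjk].
    split=> // e0; have n'E : n' = n by rewrite /n' e0 mul0n subn0.
    rewrite n'E in top_d; have [i -> max_i] := top_d lo.
    by exists i => //; rewrite ltn_eqF.
  have [le_dj zero_dj] := adm_d j ltjk; split=> // /zero_dj[i def_j max_i].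
  by exists i => //; rewrite ltn_eqF // -ltnS -def_j ltnW.
- exists k; rewrite // eqxx; apply/eqP; rewrite eqn_leq e_le /=.
  by rewrite leq_divRL //; lia.
- rewrite big_ord_recr /= eqxx -n_split -sum_d; congr (_ + _)%N.
  by apply: eq_bigr => i _; rewrite ltn_eqF.
Qed.

(** The ranges in [digits_exist] for lengths from 0 to r overlap and cover every
    n below q_(r+1) = q_r + q_(r-1).  An admissible sequence is a
    sequence of [digits_exist] of some length m, padded with zeros. *)
Lemma Psi_surj {r} (a : r.-tuple nat) (n : nat) :
  (forall j : 'I_r, (0 < tnth a j)%N) -> (n < cvg_den a r.+1)%N ->
  exists2 d, admissible a d & Psi a d = n.
Proof.
move=> ha ltn.
have bracket k : (k <= r)%N -> (n < prev_den a k.+1 + prev_den a k)%N ->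
    exists2 m, (m <= r)%N &
      (prev_den a m <= n < prev_den a m.+1 + prev_den a m)%N.
  elim: k => [|k IHk] lekr hi; first by exists 0%N.
  have [ltn_k | len_k] := ltnP n (prev_den a k.+1).
    by apply: (IHk (ltnW lekr)); rewrite ltn_addr.
  by exists k.+1; rewrite // len_k.
have [m lemr m_bounds] : exists2 m, (m <= r)%N &
    (prev_den a m <= n < prev_den a m.+1 + prev_den a m)%N.
  by apply: (bracket r) => //; rewrite -den_last.
have [d [adm_d _ sum_d]] := digits_exist a m n ha lemr m_bounds.
exists [tuple (if (j < m)%N then d j else 0%N) | j < r].
  apply/admissible_nth => j ltjr.
  have nthE i : nth 0%N [tuple (if (j < m)%N then d j else 0%N) | j < r] i
                = if (i < m)%N then d i else 0%N.
    have [ltir | leri] := ltnP i r.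
      by rewrite -(tnth_nth _ _ (Ordinal ltir)) tnth_mktuple.
    by rewrite nth_default ?size_tuple // ltnNge (leq_trans lemr leri).
  rewrite nthE; case: (ltnP j m) => [ltjm | lemj].
    have [le_dj zero_dj] := adm_d j ltjm; split=> // /zero_dj[i def_j max_i].
    have ltim : (i < m)%N by rewrite ltnW // -def_j.
    by right; exists i; rewrite // nthE ltim.
  by split=> // _; left=> i leji; rewrite nthE ltnNge (leq_trans lemj leji).
rewrite -sum_d /Psi (big_ord_widen _ (fun j => d j * cvg_den a j)%N lemr).
rewrite [RHS]big_mkcond /=; apply: eq_bigr => j _; rewrite tnth_mktuple.
by case: ifP.
Qed.

(** * Fractional parts and the bijections *)

Lemma Lambda_Psi {r} (a d : r.-tuple nat) :
  (Psi a d)%:R * cfrac_of a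
    = Lambda a d + (\sum_(j < r) tnth d j * cvg_num a j)%N%:R.
Proof.
rewrite /Psi /Lambda !natr_sum mulr_suml -big_split /=.
apply: eq_bigr => j _; rewrite /delta mulrACA -expr2 sqrr_sign mul1r !natrM.
by ring.
Qed.

Lemma fracpart_shift (x : rat) (m : int) :
  0 <= x < 1 -> fracpart (x + m%:~R) = x.
Proof.
move=> /andP[x_ge0 x_lt1]; rewrite /fracpart.
have -> : Num.floor (x + m%:~R) = m; last by rewrite addrK.
by apply: floor_def; rewrite lerDr x_ge0 intrD addrC ltrD2l.
Qed.

Lemma Lambda_fracpart {r} (a d : r.-tuple nat) :
  (forall j : 'I_r, (0 < tnth a j)%N) -> admissible a d ->
  fracpart ((Psi a d)%:R * cfrac_of a) = Lambda a d.
Proof.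
move=> ha adm; rewrite Lambda_Psi pmulrn fracpart_shift //.
exact: Lambda_bounds.
Qed.

Lemma Psi_inj {r} (a d d' : r.-tuple nat) :
  (forall j : 'I_r, (0 < tnth a j)%N) ->
  admissible a d -> admissible a d' -> Psi a d = Psi a d' -> d = d'.
Proof.
move=> ha adm adm' eqPsi; apply: (Lambda_inj a) => //.
by rewrite -!Lambda_fracpart // eqPsi.
Qed.

(** Since [cfrac_of a] has denominator [cvg_den a r.+1], so does anything that
    is congruent modulo 1 to one of its multiples. *)
Lemma den_Lambda_nat {r} (a d : r.-tuple nat) :
  (forall j : 'I_r, (0 < tnth a j)%N) -> admissible a d ->
  exists2 n, (n < cvg_den a r.+1)%N & Lambda a d = n%:R / (cvg_den a r.+1)%:R.
Proof.
move=> ha adm; have /andP[L_ge0 L_lt1] := Lambda_bounds a d ha adm.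
have q_gt0 : 0 < (cvg_den a r.+1)%:R :> rat.
  by rewrite ltr0n (prev_den_gt0 a r.+1 ha).
have L_int : (cvg_den a r.+1)%:R * Lambda a d \is a Num.nat.
  rewrite natrEint mulr_ge0 ?(ltW q_gt0) // andbT.
  have -> : Lambda a d = (Psi a d)%:R * cfrac_of a
              - (\sum_(j < r) tnth d j * cvg_num a j)%N%:R.
    by rewrite Lambda_Psi addrK.
  by rewrite mulrBr mulrCA cfrac_ofE // rpredB // rpredM ?rpred_nat.
have [n n_eq] := natrP L_int.
exists n; last by rewrite -n_eq [_ * Lambda a d]mulrC mulfK ?gt_eqF.
by rewrite -(ltr_nat rat) -n_eq gtr_pMr.
Qed.

(** The inverse of p_(r+1) modulo q_(r+1) is (-1)^r q_r, which gives the integer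
    whose multiple of alpha has fractional part n / q_(r+1). *)
Lemma Lambda_surj {r} (a : r.-tuple nat) (n : nat) :
  (forall j : 'I_r, (0 < tnth a j)%N) -> (n < cvg_den a r.+1)%N ->
  exists2 d, admissible a d & Lambda a d = n%:R / (cvg_den a r.+1)%:R.
Proof.
move=> ha ltnq.
have q_gt0 : (0 < cvg_den a r.+1)%N := prev_den_gt0 a r.+1 ha (leqnn _).
pose z : int := (-1) ^+ r * (n * cvg_den a r)%N%:Z.
pose m := `|(z %% (cvg_den a r.+1)%:Z)%Z|%N.
have q_neq0 : (cvg_den a r.+1)%:Z != 0 by rewrite eqz_nat -lt0n.
have m_eq : m%:Z = (z %% (cvg_den a r.+1)%:Z)%Z by rewrite gez0_abs ?modz_ge0.
have ltmq : (m < cvg_den a r.+1)%N by rewrite -ltz_nat m_eq ltz_pmod.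
have [d adm Psi_d] := Psi_surj a m ha ltmq.
exists d => //; rewrite -Lambda_fracpart // Psi_d.
have -> : m%:R * cfrac_of a = n%:R / (cvg_den a r.+1)%:R
  + ((-1) ^+ r * (n * cvg_num a r)%N%:Z
     - (z %/ (cvg_den a r.+1)%:Z)%Z * (cvg_num a r.+1)%:Z)%:~R.
  have z_eq := divz_eq z (cvg_den a r.+1)%:Z.
  rewrite -m_eq in z_eq.
  have -> : m%:R = z%:~R - (z %/ (cvg_den a r.+1)%:Z)%Z%:~R * (cvg_den a r.+1)%:R :> rat.
    by rewrite {1}z_eq rmorphD rmorphM /= addrAC subrr add0r.
  rewrite mulrBl -mulrA cfrac_ofE // -delta_last // /delta /z.
  rewrite !(rmorphB, rmorphM, rmorphXn, rmorphN1) /= -!pmulrn.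
  by ring.
apply: fracpart_shift; rewrite divr_ge0 ?ler0n //=.
by rewrite ltr_pdivrMr ?ltr0n // mul1r ltr_nat.
Qed.

Theorem proposition3 (alpha : rat) (r : nat) (a : r.-tuple nat)
    (halpha : 0 <= alpha < 1)
    (hr : (1 <= r)%N)
    (ha : forall j : 'I_r, (0 < tnth a j)%N)
    (hcf : alpha = cfrac_of a) :
  order_isomorphism (@alt_lex r) (fun x y : rat => x <= y)
    (admissible a)
    [set n%:R / (cvg_den a r.+1)%:R | n in `I_(cvg_den a r.+1)]
    (Lambda a)
  /\
  (set_bij (admissible a) `I_(cvg_den a r.+1) (Psi a) /\
   forall n : nat, (n < cvg_den a r.+1)%N ->
     fracpart (n%:R * alpha) = Lambda a (Psi_inv a n)).
Proof.
have Psi_bij : set_bij (admissible a) `I_(cvg_den a r.+1) (Psi a).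
  split=> [d | d d' /set_mem adm /set_mem adm' | n /= ltnq].
  - exact: Psi_lt.
  - exact: Psi_inj.
  - by have [d adm Psi_d] := Psi_surj a n ha ltnq; exists d.
split; last split=> // [n ltnq].
  split=> [|d d']; last exact: alt_lex_Lambda.
  split=> [d /(den_Lambda_nat a d ha)[n ltnq L_eq] | d d' | _ [n ltnq <-]].
  - by exists n.
  - by move=> /set_mem adm /set_mem adm'; exact: Lambda_inj.
  - by have [d adm L_eq] := Lambda_surj a n ha ltnq; exists d.
have [d adm Psi_d] := Psi_surj a n ha ltnq.
have inv_n : Psi_inv a n = d.
  rewrite /Psi_inv -Psi_d; apply: pinvKV; last exact: mem_set.
  exact: (set_bij_inj Psi_bij).
by rewrite inv_n hcf -Psi_d Lambda_fracpart.
Qed.
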